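(* For all $k \geq 1$ and all $n > k$, the group $\mathrm{IA}_n(k)$ is not generated by elements supported on splittings of $F_n$ of rank less than $k$.
   Context: $F_n$ is the free group of rank $n$. For a group $G$, $\gamma_1(G)=G$ and $\gamma_{k+1}(G)=[\gamma_k(G),G]$. $\mathrm{IA}_n(k)$ is the kernel of the action of $\mathrm{Aut}(F_n)$ on $F_n/\gamma_{k+1}(F_n)$. A splitting of $F_n$ is a pair of subgroups $A,B<F_n$ with $F_n=A\ast B$; its rank is the rank of $A$. An automorphism $\varphi$ is supported on the splitting $A\ast B$ if $\varphi(A)=A$ and $\varphi|_B=\mathrm{id}$. *)

(* Defs.v *)
From Stdlib Require List.
From mathcomp Require Import all_boot.
Set Implicit Arguments. Unset Strict Implicit. Unset Printing Implicit Defensive.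

(* a letter (i, b) is x_i if b = false and x_i^{-1} if b = true *)
Definition letter (n : nat) := ('I_n * bool)%type.
Definition linv (n : nat) (x : letter n) : letter n := (x.1, ~~ x.2).

Fixpoint reduced (n : nat) (w : seq (letter n)) : bool :=
  match w with
  | x :: ((y :: _) as w') => (y != linv x) && reduced w'
  | _ => true
  end.

Definition cons_red (n : nat) (x : letter n) (w : seq (letter n)) :=
  if w is y :: w' then (if y == linv x then w' else x :: w) else [:: x].

Definition wnorm (n : nat) (w : seq (letter n)) : seq (letter n) :=
  foldr (@cons_red n) [::] w.

Lemma reduced_cons_red (n : nat) (x : letter n) w :
  reduced w -> reduced (cons_red x w).
Proof.
case: w => [|y w'] //= H.
case: eqP => [_|/eqP ne].
  by case: w' H => [|z w''] //= /andP [].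
by rewrite /= ne H.
Qed.

Lemma reduced_wnorm (n : nat) (w : seq (letter n)) : reduced (wnorm w).
Proof. by elim: w => [|x w IH] //=; apply: reduced_cons_red. Qed.

Record FreeGroup (n : nat) := FG { fgw : seq (letter n); fgP : reduced fgw }.

Definition fg1 (n : nat) : FreeGroup n := @FG n [::] isT.
Definition fgmul (n : nat) (u v : FreeGroup n) : FreeGroup n :=
  FG (reduced_wnorm (fgw u ++ fgw v)).
Definition fginv (n : nat) (u : FreeGroup n) : FreeGroup n :=
  FG (reduced_wnorm (rev (map (@linv n) (fgw u)))).

Inductive subgen (n : nat) (S : FreeGroup n -> Prop) : FreeGroup n -> Prop :=
  | sg1 : subgen S (fg1 n)
  | sgS x : S x -> subgen S x
  | sgM x y : subgen S x -> subgen S y -> subgen S (fgmul x y)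
  | sgV x : subgen S x -> subgen S (fginv x).

Definition is_subgroup (n : nat) (A : FreeGroup n -> Prop) : Prop :=
  [/\ A (fg1 n), (forall x y, A x -> A y -> A (fgmul x y))
    & (forall x, A x -> A (fginv x))].

Definition fgcomm (n : nat) (x y : FreeGroup n) : FreeGroup n :=
  fgmul (fgmul (fginv x) (fginv y)) (fgmul x y).

(* lcs n m = gamma_{m+1}(F_n): lcs n 0 = F_n,
   lcs n m.+1 = [lcs n m, F_n] *)
Fixpoint lcs (n m : nat) : FreeGroup n -> Prop :=
  match m with
  | 0 => fun _ => True
  | m'.+1 => @subgen n (fun z => exists a g, @lcs n m' a /\ z = fgcomm a g)
  end.

Definition is_hom (n : nat) (f : FreeGroup n -> FreeGroup n) : Prop :=
  forall x y, f (fgmul x y) = fgmul (f x) (f y).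

Definition is_aut (n : nat) (f : FreeGroup n -> FreeGroup n) : Prop :=
  is_hom f /\ bijective f.

(* IA_n(k): automorphisms acting trivially on F_n / gamma_{k+1}(F_n),
   i.e. x^-1 phi(x) \in gamma_{k+1}(F_n) for all x. *)
Arguments lcs : clear implicits.
Definition IA (n k : nat) (phi : FreeGroup n -> FreeGroup n) : Prop :=
  is_aut phi /\ forall x, lcs n k (fgmul (fginv x) (phi x)).

Arguments IA : clear implicits.

Definition fgprod (n : nat) (s : seq (FreeGroup n)) : FreeGroup n :=
  foldr (@fgmul n) (fg1 n) s.

(* F_n = A * B (internal free product): A, B subgroups generating F_n, and
   every nonempty alternating word of nontrivial elements (labelled by the
   factor they come from) has nontrivial product. *)
Definition splitting (n : nat) (A B : FreeGroup n -> Prop) : Prop :=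
  [/\ is_subgroup A, is_subgroup B,
      (forall x, subgen (fun y => A y \/ B y) x)
    & forall s : seq (bool * FreeGroup n),
        s <> [::] ->
        (forall p, List.In p s -> (if p.1 then A p.2 else B p.2) /\ p.2 <> fg1 n) ->
        (forall i, i.+1 < size s ->
           (nth (true, fg1 n) s i).1 != (nth (true, fg1 n) s i.+1).1) ->
        fgprod (map snd s) <> fg1 n].

Definition rank_lt (n : nat) (A : FreeGroup n -> Prop) (k : nat) : Prop :=
  exists s : seq (FreeGroup n),
    size s < k /\ forall x, A x <-> subgen (fun y => List.In y s) x.

Definition supported (n : nat) (phi : FreeGroup n -> FreeGroup n)
  (A B : FreeGroup n -> Prop) : Prop :=
  [/\ (forall a, A a -> A (phi a)),
      (forall a, A a -> exists a', A a' /\ phi a' = a)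
    & (forall b, B b -> phi b = b)].

Inductive autgen (n : nat) (S : (FreeGroup n -> FreeGroup n) -> Prop) :
    (FreeGroup n -> FreeGroup n) -> Prop :=
  | ag1 : autgen S id
  | agS f : S f -> autgen S f
  | agM f g : autgen S f -> autgen S g -> autgen S (f \o g)
  | agV f g : autgen S f -> cancel f g -> cancel g f -> autgen S g.

(* Main.v *)
(* If phi is in IA_n(k), the degree k+1 part of the Magnus expansion of
   x^-1 phi(x) is a homomorphism from F_n to H^(k+1) (tensor power of
   H = F_n^ab).  If phi is supported on A * B, it kills B and maps A into the
   tensor power of A^ab, since the retraction of F_n onto A shows that
   gamma_(k+1)(F_n) meets A in gamma_(k+1)(A).  When A has rank < k, the
   antisymmetrization H^(k+1) -> H (x) Lambda^k H of the last k factors vanishes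
   on that tensor power.  Hence the coordinate alt_coef of this projection on
   x_0 (x) (x_1 ^ .. ^ x_k) satisfies alt_coef (phi x) = alt_coef x for every
   supported phi, and so for every product of such phi.  Conjugating x_k by
   [..[x_0, x_1], .., x_(k-1)] and fixing the other generators gives an element
   of IA_n(k) under which alt_coef x_k changes, because only the word
   x_0 x_1 .. x_k in the expansion of [..[x_0, x_1], .., x_k] starts with x_0. *)
Require Import Defs.
From HB Require Import structures.
From mathcomp Require Import all_boot all_algebra perm.
Import GRing.Theory.
Set Implicit Arguments. Unset Strict Implicit. Unset Printing Implicit Defensive.

(** * Free reduction and the group of reduced words *)

Lemma linvK (n : nat) : involutive (@linv n).
Proof. by case=> i b; rewrite /linv /= negbK. Qed.

(** If [w] starts with [x], the inner step deletes that letter and the outer step restores it, since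
    reducedness keeps [linv x] from coming next. *)
Lemma cons_redK (n : nat) (x : letter n) (w : seq (letter n)) :
  reduced w -> cons_red x (cons_red (linv x) w) = w.
Proof.
case: w => [|y w] /=; first by rewrite eqxx.
rewrite linvK; case: eqP => [->|ne].
  by case: w => [|z w] //= /andP [/negbTE ->].
by move=> _ /=; rewrite eqxx.
Qed.

Lemma reduced_foldr (n : nat) (u v : seq (letter n)) :
  reduced v -> reduced (foldr (@cons_red n) v u).
Proof. by move=> rv; elim: u => //= x u; apply: reduced_cons_red. Qed.

Lemma foldr_cons_red (n : nat) (x : letter n) (u v : seq (letter n)) :
  reduced v ->
  foldr (@cons_red n) v (cons_red x u) = cons_red x (foldr (@cons_red n) v u).
Proof.
case: u => [|y u] //= rv; case: eqP => [->|] //=.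
by rewrite cons_redK // reduced_foldr.
Qed.

(** Each letter permutes the reduced words, with its formal inverse acting as the inverse
    permutation, so a word acts as its normal form does. Associativity of [fgmul] follows. *)
Lemma foldr_wnorm (n : nat) (u v : seq (letter n)) :
  reduced v -> foldr (@cons_red n) v (wnorm u) = foldr (@cons_red n) v u.
Proof. by move=> rv; elim: u => //= x u IH; rewrite foldr_cons_red // IH. Qed.

Lemma wnorm_cat (n : nat) (u v : seq (letter n)) :
  wnorm (u ++ v) = foldr (@cons_red n) (wnorm v) u.
Proof. by rewrite /wnorm foldr_cat. Qed.

Lemma wnorm_id (n : nat) (w : seq (letter n)) : reduced w -> wnorm w = w.
Proof.
elim: w => [|x w IH] //= rw.
rewrite IH; last by case: w rw {IH} => //= y w /andP [].
by case: w rw {IH} => //= y w /andP [/negbTE ->].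
Qed.

Lemma fgw_inj (n : nat) : injective (@fgw n).
Proof.
case=> u pu [v pv] /= E; case: v / E pv => pv.
by rewrite (eq_irrelevance pu pv).
Qed.

Definition fg_of_word (n : nat) (w : seq (letter n)) : FreeGroup n :=
  FG (reduced_wnorm w).

Lemma fgwK (n : nat) : cancel (@fgw n) (@fg_of_word n).
Proof. by case=> w rw; apply: fgw_inj; rewrite /= wnorm_id. Qed.

HB.instance Definition _ (n : nat) := Choice.copy (FreeGroup n) (can_type (@fgwK n)).

Lemma fgmulA (n : nat) : associative (@fgmul n).
Proof.
move=> [u ru] [v rv] [w rw]; apply: fgw_inj; rewrite /= (wnorm_cat u).
rewrite (wnorm_id (reduced_wnorm _)) (wnorm_cat v) (wnorm_cat (wnorm _)).
by rewrite foldr_wnorm ?reduced_wnorm // foldr_cat.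
Qed.

Lemma fgmul1 (n : nat) : left_id (fg1 n) (@fgmul n).
Proof. by case=> u ru; apply: fgw_inj; rewrite /= wnorm_id. Qed.

Lemma fgmulr1 (n : nat) : right_id (fg1 n) (@fgmul n).
Proof. by case=> u ru; apply: fgw_inj; rewrite /= cats0 wnorm_id. Qed.

Lemma wnormV (n : nat) (w : seq (letter n)) :
  wnorm (w ++ rev (map (@linv n) w)) = [::].
Proof.
elim: w => [|x w IH] //=.
rewrite rev_cons -cats1 catA wnorm_cat -foldr_wnorm ?reduced_wnorm // IH /=.
by rewrite eqxx.
Qed.

Lemma fgmulV (n : nat) : right_inverse (fg1 n) (@fginv n) (@fgmul n).
Proof.
case=> u ru; apply: fgw_inj; rewrite /= wnorm_cat (wnorm_id (reduced_wnorm _)).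
by rewrite -wnorm_cat wnormV.
Qed.

Lemma fgmulVl (n : nat) : left_inverse (fg1 n) (@fginv n) (@fgmul n).
Proof.
move=> x; rewrite -[X in fgmul _ X]fgmulr1 -(fgmulV (fginv x)).
by rewrite (fgmulA x) fgmulV fgmul1.
Qed.

HB.instance Definition _ (n : nat) :=
  isGroup.Build (FreeGroup n) (@fgmulA n) (@fgmul1 n) (@fgmulr1 n)
    (@fgmulVl n) (@fgmulV n).

(** * Lower central series, universal property and homomorphisms *)

Section GroupTheory.
Local Open Scope group_scope.

Lemma fgcommE (n : nat) (x y : FreeGroup n) : fgcomm x y = [~ x, y].
Proof. by rewrite /commg /conjg mulgA. Qed.

Lemma subgen_min (n : nat) (S P : FreeGroup n -> Prop) :
  is_subgroup P -> (forall y, S y -> P y) -> forall x, subgen S x -> P x.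
Proof. by case=> P1 PM PV SP x; elim=> *; auto. Qed.

Lemma subgen_is_subgroup (n : nat) (S : FreeGroup n -> Prop) :
  is_subgroup (subgen S).
Proof. by split; [exact: sg1 | exact: sgM | exact: sgV]. Qed.

Lemma lcs_is_subgroup (n d : nat) : is_subgroup (lcs n d).
Proof. by case: d => [|d] //; apply: subgen_is_subgroup. Qed.

Lemma lcs_conj (n d : nat) (g x : FreeGroup n) : lcs n d g -> lcs n d (g ^ x).
Proof.
elim: d g => [|d IH] g //=.
apply: (@subgen_min _ _ (fun g => lcs n d.+1 (g ^ x))).
  by case: (lcs_is_subgroup n d.+1) => l1 lM lV; split=> [|y z Hy Hz|y Hy];
     rewrite ?(conj1g, conjMg, conjVg) //; [exact: lM | exact: lV].
move=> _ [a [h [Ha ->]]]; apply: sgS; exists (a ^ x), (h ^ x); split; first exact: IH.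
by rewrite !fgcommE conjRg.
Qed.

Section UniversalProperty.
Variables (n : nat) (T : Type) (idx : T) (op : Monoid.law idx) (f : letter n -> T).
Hypothesis fV : forall l, op (f l) (f (linv l)) = idx.

(** The target is only a monoid, so that one construction serves matrices under multiplication,
    integers under addition and the free group itself. *)
Definition fg_ev (x : FreeGroup n) : T := \big[op/idx]_(l <- fgw x) f l.

Lemma big_cons_red l w :
  \big[op/idx]_(j <- cons_red l w) f j = op (f l) (\big[op/idx]_(j <- w) f j).
Proof.
case: w => [|y w] /=; first by rewrite big_seq1 big_nil Monoid.mulm1.
case: eqP => [->|_]; rewrite !big_cons //.
set b := bigop _ _ _; transitivity (op (op (f l) (f (linv l))) b).
  by rewrite fV Monoid.mul1m.
exact/esym/Monoid.mulmA.
Qed.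

Lemma big_wnorm w : \big[op/idx]_(j <- wnorm w) f j = \big[op/idx]_(j <- w) f j.
Proof. by elim: w => //= l w IH; rewrite big_cons_red IH big_cons. Qed.

Lemma fg_evM : {morph fg_ev : x y / fgmul x y >-> op x y}.
Proof. by move=> x y; rewrite /fg_ev big_wnorm big_cat. Qed.

Lemma fg_ev1 : fg_ev (fg1 n) = idx.
Proof. exact: big_nil. Qed.

End UniversalProperty.

Definition fgen (n : nat) (i : 'I_n) : FreeGroup n := @FG n [:: (i, false)] isT.

Lemma fg_ind (n : nat) (P : FreeGroup n -> Prop) :
  is_subgroup P -> (forall i, P (fgen i)) -> forall x, P x.
Proof.
case=> P1 PM PV Pi [w rw].
have : P (fg_of_word w).
  elim: w {rw} => [|[i b] w IH]; first by congr P: P1; apply: fgw_inj.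
  have -> : fg_of_word ((i, b) :: w) =
            (if b then fginv (fgen i) else fgen i) * fg_of_word w.
    by apply: fgw_inj; case: b; rewrite /= (wnorm_id (reduced_wnorm w)).
  by apply: PM => //; case: b; [apply: PV|].
by congr P; apply: fgw_inj; rewrite /= wnorm_id.
Qed.

Section Homs.
Variables (n : nat) (f : FreeGroup n -> FreeGroup n).
Hypothesis fM : is_hom f.

Lemma homM x y : f (x * y) = f x * f y.
Proof. exact: fM. Qed.

Lemma hom1 : f 1 = 1.
Proof. by apply: (@mulgI _ (f 1)); rewrite -homM !mulg1. Qed.

Lemma homV x : f x^-1 = (f x)^-1.
Proof. by apply: (@mulgI _ (f x)); rewrite -homM !mulgV hom1. Qed.

Lemma homJ x y : f (x ^ y) = f x ^ f y.
Proof. by rewrite /conjg !homM homV. Qed.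
End Homs.

(* The displacement x^-1 f(x) is multiplicative up to conjugation. *)
Lemma IA_of_gens (n k : nat) (f : FreeGroup n -> FreeGroup n) :
  is_hom f -> (forall i, lcs n k ((fgen i)^-1 * f (fgen i))) ->
  forall x, lcs n k (x^-1 * f x).
Proof.
move=> fM; case: (lcs_is_subgroup n k) => l1 lM lV.
apply: fg_ind; split.
- by rewrite -[fg1 n]/(1 : FreeGroup n) (hom1 fM) mulVg.
- move=> x y Hx Hy; rewrite -[fgmul x y]/(x * y) (homM fM).
  have -> : (x * y)^-1 * (f x * f y) = (x^-1 * f x) ^ y * (y^-1 * f y).
    by rewrite /conjg invgM !mulgA mulgK.
  by apply: lM => //; apply: lcs_conj.
- move=> x Hx; rewrite -[fginv x]/(x^-1) (homV fM) invgK.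
  have -> : x * (f x)^-1 = (x^-1 * f x)^-1 ^ (x^-1).
    by rewrite /conjg invgM !invgK !mulgA mulgK.
  by apply: lcs_conj; apply: lV.
Qed.

End GroupTheory.

(** * The Magnus expansion *)

Section Magnus.
Local Open Scope ring_scope.

(** These conditions form a multiplicative filtration, the matrix counterpart of the lowest degree
    of a truncated noncommutative power series. *)
Definition upper_from (m d : nat) (A : 'M[int]_m.+1) : Prop :=
  forall i j : 'I_m.+1, (j < i + d)%N -> A i j = 0.

Lemma mulB1 (R : nzRingType) (x y : R) :
  x * y - 1 = (x - 1) + (y - 1) + (x - 1) * (y - 1).
Proof.
rewrite -{1}(subrK 1 x) -{1}(subrK 1 y) mulrDl mulrDr mul1r mulr1.
by move: (x - 1) (y - 1) => u v; rewrite addrA addrK -addrA addrC.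
Qed.

Section Filtration.
Variable m : nat.
Implicit Types A B : 'M[int]_m.+1.

Lemma upper_fromW d d' A : (d <= d')%N -> upper_from d' A -> upper_from d A.
Proof. by move=> le HA i j ij; apply: HA; apply: leq_trans ij _; rewrite leq_add2l. Qed.

Lemma upper_fromD d A B : upper_from d A -> upper_from d B -> upper_from d (A + B).
Proof. by move=> HA HB i j ij; rewrite !mxE HA ?HB ?addr0. Qed.

Lemma upper_fromN d A : upper_from d A -> upper_from d (- A).
Proof. by move=> HA i j ij; rewrite !mxE HA ?oppr0. Qed.

Lemma upper_fromM d e A B :
  upper_from d A -> upper_from e B -> upper_from (d + e)%N (A * B).
Proof.
move=> HA HB i j ij; rewrite mxE big1 // => c _.
case: (ltnP c (i + d)) => h; first by rewrite HA ?mul0r.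
by rewrite HB ?mulr0 //; apply: leq_trans ij _; rewrite addnA leq_add2r.
Qed.

Lemma upper_from_eq0 A : upper_from m.+1 A -> A = 0.
Proof.
by move=> HA; apply/matrixP => i j; rewrite HA ?mxE // (leq_trans (ltn_ord j)) ?leq_addl.
Qed.

Lemma upper_fromX A k : upper_from 1 A -> upper_from k (A ^+ k).
Proof.
move=> HA; elim: k => [|k IH].
  move=> i j; rewrite addn0 expr0 mxE => ji; case: eqP => // E.
  by rewrite E ltnn in ji.
by rewrite exprS -add1n; apply: upper_fromM.
Qed.

(** Only the summand at [c] survives: smaller indices kill the entry of [A], larger ones the entry
    of [B]. *)
Lemma mul_lead_entry d e A B (a c b : 'I_m.+1) :
  upper_from d A -> upper_from e B -> c = (a + d)%N :> nat -> b = (c + e)%N :> nat ->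
  (A * B) a b = A a c * B c b.
Proof.
move=> HA HB Ec Eb; rewrite mxE (bigD1 c) //= big1 ?addr0 // => i ic.
case: (ltngtP i c) => h.
- by rewrite HA ?mul0r // -Ec.
- by rewrite HB ?mulr0 // Eb ltn_add2r.
- by move/eqP: ic; case; apply: val_inj.
Qed.
End Filtration.

Variables n m : nat.
Implicit Types (l : nat -> 'I_n -> int) (x y g : FreeGroup n).

(* Over all weights l, the entries of this unipotent representation
   x_i |-> 1 + sum_a l_a(i) E_(a, a+1) give the Magnus coefficients of degree
   at most m. *)
Definition magnus_nil l (i : 'I_n) : 'M[int]_m.+1 :=
  \matrix_(a, b) if b == a.+1 :> nat then l a i else 0.

(** The inverse of 1 + N is a finite geometric series, because N is strictly upper triangular of
    size [m.+1]. *)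
Definition magnus_letter l (c : letter n) : 'M[int]_m.+1 :=
  if c.2 then \sum_(t < m.+1) (- magnus_nil l c.1) ^+ t else 1 + magnus_nil l c.1.

Lemma magnus_nil_upper l i : upper_from 1 (magnus_nil l i).
Proof.
by move=> a b; rewrite mxE addn1 => ab; case: eqP => // E; rewrite E ltnn in ab.
Qed.

Lemma magnus_letterV l c : magnus_letter l c * magnus_letter l (linv c) = 1.
Proof.
case: c => i b; pose N := magnus_nil l i.
suff E : (1 + N) * \sum_(t < m.+1) (- N) ^+ t = 1.
  by case: b => //; rewrite /magnus_letter /=; apply: mulmx1C.
have := subrX1 (- N) m.+1; rewrite -opprD mulNr (addrC N).
rewrite (upper_from_eq0 (upper_fromX (upper_fromN (magnus_nil_upper l i)))) add0r.
by move/oppr_inj.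
Qed.

Definition magnus l x : 'M[int]_m.+1 := fg_ev *%R (magnus_letter l) x.

Definition magnus_pos l x : 'M[int]_m.+1 := magnus l x - 1.

Lemma magnusM l x y : magnus l (x * y)%g = magnus l x * magnus l y.
Proof. exact: fg_evM (magnus_letterV l) _ _. Qed.

Lemma magnus1 l : magnus l 1%g = 1.
Proof. exact: fg_ev1. Qed.

Lemma magnus_posM l x y :
  magnus_pos l (x * y)%g =
  magnus_pos l x + magnus_pos l y + magnus_pos l x * magnus_pos l y.
Proof.
by rewrite /magnus_pos magnusM mulB1.
Qed.

Lemma magnus_pos_upper l x : upper_from 1 (magnus_pos l x).
Proof.
rewrite /magnus_pos /magnus /fg_ev.
apply: (big_ind (fun A : 'M[int]_m.+1 => upper_from 1 (A - 1))).
- by rewrite subrr => i j _; rewrite mxE.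
- move=> A B HA HB; rewrite mulB1; apply: upper_fromD; first exact: upper_fromD.
  by apply: upper_fromW (upper_fromM HA HB).
- case=> i b _; case: b; rewrite /magnus_letter /=.
    rewrite big_ord_recl expr0 addrC addKr.
    apply: (big_ind (upper_from 1)); first by move=> a c _; rewrite mxE.
      by move=> *; apply: upper_fromD.
    move=> t _; apply: (@upper_fromW _ _ t.+1) => //; apply: upper_fromX.
    exact: upper_fromN (magnus_nil_upper l i).
  by rewrite addrC addKr; apply: magnus_nil_upper.
Qed.

(** This is the linear form [l a] evaluated at the class of [x] in the abelianization. *)
Definition expsum l a x : int :=
  fg_ev +%R (fun c : letter n => if c.2 then - l a c.1 else l a c.1) x.

Lemma expsumM l a x y : expsum l a (x * y)%g = expsum l a x + expsum l a y.
Proof. by apply: fg_evM => -[i []] /=; rewrite ?subrr ?addNr. Qed.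

Lemma expsum1 l a : expsum l a 1%g = 0.
Proof. exact: fg_ev1. Qed.

Lemma expsumV l a x : expsum l a x^-1%g = - expsum l a x.
Proof. by apply/eqP; rewrite -addr_eq0 -expsumM mulVg expsum1. Qed.

Lemma expsum_fgen l a i : expsum l a (fgen i) = l a i.
Proof. by rewrite /expsum /fg_ev big_seq1. Qed.

(** The product term of [magnus_posM] lies in degree 2(d+1), beyond the superdiagonal d+1. *)
Lemma magnus_pos_mul_lead l x y d (a b : 'I_m.+1) :
  upper_from d.+1 (magnus_pos l x) -> upper_from d.+1 (magnus_pos l y) ->
  b = (a + d.+1)%N :> nat ->
  magnus_pos l (x * y)%g a b = magnus_pos l x a b + magnus_pos l y a b.
Proof.
move=> Hx Hy Eb; rewrite magnus_posM 2!mxE (upper_fromM Hx Hy) ?addr0 ?mxE //.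
by rewrite Eb ltn_add2l addSn ltnS addnS ltnS leq_addr.
Qed.

Lemma magnus_posM_upper l x y d :
  upper_from d.+1 (magnus_pos l x) -> upper_from d.+1 (magnus_pos l y) ->
  upper_from d.+1 (magnus_pos l (x * y)%g).
Proof.
move=> Hx Hy; rewrite magnus_posM; apply: upper_fromD; first exact: upper_fromD.
by apply: upper_fromW (upper_fromM Hx Hy); rewrite leq_addr.
Qed.

Lemma magnus_pos1 l : magnus_pos l 1%g = 0.
Proof. by rewrite /magnus_pos magnus1 subrr. Qed.

(** Expanding x x^-1 = 1 gives X + Y + XY = 0, so Y = -X - XY, where XY is at least as deep as X. *)
Lemma magnus_posV_upper l x d :
  upper_from d.+1 (magnus_pos l x) -> upper_from d.+1 (magnus_pos l x^-1%g).
Proof.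
move=> Hx; have := magnus_posM l x x^-1%g; rewrite mulgV magnus_pos1.
move/eqP; rewrite eq_sym -addrA addrC addr_eq0 => /eqP E.
suff -> : magnus_pos l x^-1%g =
  - magnus_pos l x + - (magnus_pos l x * magnus_pos l x^-1%g).
  apply: upper_fromD; apply: upper_fromN => //.
  by apply: upper_fromW (upper_fromM Hx (magnus_pos_upper l x^-1%g)); rewrite leq_addr.
by rewrite -E addrK.
Qed.

Lemma magnus_posV_lead l x d (a b : 'I_m.+1) :
  upper_from d.+1 (magnus_pos l x) -> b = (a + d.+1)%N :> nat ->
  magnus_pos l x^-1%g a b = - magnus_pos l x a b.
Proof.
move=> Hx Eb; apply/eqP; rewrite -addr_eq0.
by rewrite -(magnus_pos_mul_lead _ Hx Eb) ?mulVg ?magnus_pos1 ?mxE //; apply: magnus_posV_upper.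
Qed.

Lemma magnus_pos_expsum l x (a b : 'I_m.+1) :
  b = a.+1 :> nat -> magnus_pos l x a b = expsum l a x.
Proof.
move=> Eb; move: x; apply: fg_ind => [|i]; last first.
  rewrite expsum_fgen /magnus_pos /magnus /fg_ev big_seq1 /magnus_letter /=.
  by rewrite addrC addKr mxE Eb eqxx.
have Eb' : b = (a + 1)%N :> nat by rewrite addn1.
split.
- by rewrite -[fg1 n]/(1%g : FreeGroup n) magnus_pos1 expsum1 mxE.
- move=> x y Hx Hy; rewrite -[fgmul x y]/(x * y)%g.
  by rewrite (magnus_pos_mul_lead _ _ Eb') ?expsumM ?Hx ?Hy //; apply: magnus_pos_upper.
- move=> x Hx; rewrite -[fginv x]/(x^-1)%g.
  by rewrite (magnus_posV_lead _ Eb') ?expsumV ?Hx //; apply: magnus_pos_upper.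
Qed.

(** Writing [g, x] as (xg)^-1 (gx) isolates the ring commutator of the positive parts, up to a
    unipotent left factor. *)
Lemma magnus_pos_comm l g x :
  magnus_pos l [~ g, x]%g =
  (1 + magnus_pos l (x * g)^-1%g) *
  (magnus_pos l g * magnus_pos l x - magnus_pos l x * magnus_pos l g).
Proof.
have -> : [~ g, x]%g = ((x * g)^-1 * (g * x))%g.
  by rewrite /commg /conjg invgM !mulgA.
have -> : magnus_pos l g * magnus_pos l x - magnus_pos l x * magnus_pos l g =
          magnus l (g * x)%g - magnus l (x * g)%g.
  have E u : magnus l u = magnus_pos l u + 1 by rewrite subrK.
  rewrite (E (g * x)%g) (E (x * g)%g) !magnus_posM opprD addrACA subrr addr0.
  by rewrite (addrC (magnus_pos l x) (magnus_pos l g)) opprD addrACA subrr add0r.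
rewrite /magnus_pos magnusM (addrC 1) subrK mulrBr -(magnusM _ _ (x * g)%g) mulVg.
by rewrite magnus1 2!magnusM.
Qed.

Lemma magnus_pos_comm_upper l g x d :
  upper_from d.+1 (magnus_pos l g) -> upper_from d.+2 (magnus_pos l [~ g, x]%g).
Proof.
move=> Hg; rewrite magnus_pos_comm mulrDl mul1r.
set D := _ - _; suff HD : upper_from d.+2 D.
  apply: upper_fromD => //.
  by apply: upper_fromW (upper_fromM (magnus_pos_upper l _) HD); rewrite add1n.
apply: upper_fromD; last apply: upper_fromN.
  by rewrite -[d.+2]addn1; apply: upper_fromM => //; apply: magnus_pos_upper.
by rewrite -[d.+2]add1n; apply: upper_fromM => //; apply: magnus_pos_upper.
Qed.

(** The leading term of a group commutator is the Lie bracket of the leading terms. The letter [x]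
    is read last, at position a+d+1, or first, at position a. *)
Lemma magnus_pos_comm_lead l g x d (a b c c' : 'I_m.+1) :
  upper_from d.+1 (magnus_pos l g) ->
  c = (a + d.+1)%N :> nat -> c' = a.+1 :> nat -> b = (a + d.+2)%N :> nat ->
  magnus_pos l [~ g, x]%g a b =
  magnus_pos l g a c * expsum l (a + d.+1)%N x - expsum l a x * magnus_pos l g c' b.
Proof.
move=> Hg Ec Ec' Eb; rewrite magnus_pos_comm mulrDl mul1r.
have Hx := magnus_pos_upper l x.
set D := _ - _; have HD : upper_from d.+2 D.
  apply: upper_fromD; last apply: upper_fromN.
    by rewrite -[d.+2]addn1; apply: upper_fromM.
  by rewrite -[d.+2]add1n; apply: upper_fromM.
rewrite mxE (upper_fromM (magnus_pos_upper l _) HD); last first.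
  by rewrite Eb ltn_add2l add1n.
rewrite addr0 /D mxE [X in _ + X]mxE.
have Ec1 : c = (a + d.+1)%N :> nat by [].
have Eb1 : b = (c + 1)%N :> nat by rewrite Eb Ec addn1 !addnS.
have Ec2 : c' = (a + 1)%N :> nat by rewrite addn1.
have Eb2 : b = (c' + d.+1)%N :> nat by rewrite Eb Ec' addSn !addnS.
rewrite (mul_lead_entry Hg Hx Ec1 Eb1) (mul_lead_entry Hx Hg Ec2 Eb2).
rewrite (@magnus_pos_expsum _ _ a c') // (@magnus_pos_expsum _ _ c b) ?Ec //.
by rewrite Eb addnS.
Qed.
End Magnus.

(** * The retraction onto a free factor *)

Lemma In_mem (T : eqType) (x : T) (s : seq T) : List.In x s <-> x \in s.
Proof.
elim: s => //= y s IH; rewrite inE; split.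
  by case=> [->|/IH ->]; rewrite ?eqxx ?orbT.
by case/predU1P=> [->|/IH]; [left | right].
Qed.

Lemma not_sorted (T : Type) (e : rel T) (s : seq T) :
  ~~ sorted e s -> exists s1 x y s2, s = s1 ++ x :: y :: s2 /\ ~~ e x y.
Proof.
elim: s => //= x [|y s] IH //=; rewrite negb_and; case/orP.
  by exists [::], x, y, s.
by case/IH=> s1 [u [v [s2 [-> Euv]]]]; exists (x :: s1), u, v, s2.
Qed.

Section Retraction.
Local Open Scope group_scope.
Variable n : nat.
Implicit Types (s t : seq (bool * FreeGroup n)) (x y : FreeGroup n).

Lemma fgprod_cat (s1 s2 : seq (FreeGroup n)) :
  fgprod (s1 ++ s2) = fgprod s1 * fgprod s2.
Proof.
by elim: s1 => [|x s1 IH] /=; rewrite ?mul1g // IH -[LHS]/(x * _) mulgA.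
Qed.

Definition tagged_prod s : FreeGroup n := fgprod (map snd s).
(** The tag [true] marks letters of [A], so dropping the others computes the retraction onto [A]. *)
Definition left_part s := filter fst s.
Definition tagged_inv s := rev [seq (p.1, p.2^-1) | p <- s].

Lemma tagged_prod_cat s t : tagged_prod (s ++ t) = tagged_prod s * tagged_prod t.
Proof. by rewrite /tagged_prod map_cat fgprod_cat. Qed.

Lemma tagged_prod_cons p s : tagged_prod (p :: s) = p.2 * tagged_prod s.
Proof. by []. Qed.

Lemma tagged_prod_inv s : tagged_prod (tagged_inv s) = (tagged_prod s)^-1.
Proof.
rewrite /tagged_inv; elim: s => [|p s IH]; first by rewrite /tagged_prod invg1.
rewrite /= rev_cons -cats1 tagged_prod_cat IH !tagged_prod_cons invgM.
by rewrite [tagged_prod [::]]/(1 : FreeGroup n) mulg1.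
Qed.

Lemma left_part_inv s : left_part (tagged_inv s) = tagged_inv (left_part s).
Proof. by rewrite /left_part /tagged_inv filter_rev filter_map. Qed.

Variables A B : FreeGroup n -> Prop.

Definition tagged_ok s : Prop :=
  forall p, p \in s -> if p.1 then A p.2 else B p.2.

Hypothesis AB : splitting A B.

Let A1 : A 1. Proof. by case: AB => -[]. Qed.
Let AM x y : A x -> A y -> A (x * y).
Proof. by case: AB => -[_ H _] _ _ _; apply: H. Qed.
Let AV x : A x -> A x^-1. Proof. by case: AB => -[_ _ H] _ _ _; apply: H. Qed.
Let BM x y : B x -> B y -> B (x * y).
Proof. by case: AB => _ [_ H _] _ _; apply: H. Qed.
Let BV x : B x -> B x^-1. Proof. by case: AB => _ [_ _ H] _ _; apply: H. Qed.

Lemma tagged_ok_cat s t : tagged_ok (s ++ t) <-> tagged_ok s /\ tagged_ok t.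
Proof.
split=> [H|[Hs Ht] p].
  by split=> p ps; apply: H; rewrite mem_cat ps ?orbT.
by rewrite mem_cat => /orP [/Hs|/Ht].
Qed.

Lemma tagged_ok_cons p s :
  tagged_ok (p :: s) <-> (if p.1 then A p.2 else B p.2) /\ tagged_ok s.
Proof.
split=> [H|[Hp Hs] q]; last by rewrite inE => /predU1P [->|/Hs].
by split=> [|q qs]; apply: H; rewrite inE ?eqxx ?qs ?orbT.
Qed.

Lemma tagged_ok_inv s : tagged_ok s -> tagged_ok (tagged_inv s).
Proof.
move=> Hs p; rewrite mem_rev => /mapP [q /Hs Hq ->] /=.
by case: q.1 Hq; auto.
Qed.

(* A word in A and B with trivial product is not alternating, so it contains a
   trivial letter or two consecutive letters of one factor; removing or merging
   them changes neither product. *)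
Lemma left_part_trivial s :
  tagged_ok s -> tagged_prod s = 1 -> tagged_prod (left_part s) = 1.
Proof.
elim: {s}(size s).+1 {-2}s (ltnSn (size s)) => // N IH s sN ok ps.
have [/hasP [p ps1 /eqP p1]|no1] := boolP (has (fun p => p.2 == 1) s).
  case/splitPr: ps1 sN ok ps => s1 s2; rewrite size_cat /= addnS => sN.
  rewrite tagged_ok_cat tagged_ok_cons => -[ok1 [_ ok2]].
  rewrite tagged_prod_cat tagged_prod_cons p1 mul1g -tagged_prod_cat => ps.
  have := IH (s1 ++ s2); rewrite size_cat tagged_ok_cat ps /left_part !filter_cat /=.
  move=> H; rewrite -{}H //; case: (p.1) => //.
  by rewrite !tagged_prod_cat tagged_prod_cons p1 mul1g.
have [alt|/not_sorted] := boolP (sorted (fun p q => p.1 != q.1) s).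
  have [->|/eqP s0] := eqVneq s [::]; first by [].
  case: AB => _ _ _ /(_ s s0) []; last exact: ps.
    move=> p /In_mem pins; split; first exact: ok.
    by move=> p1; case/hasP: no1; exists p => //; apply/eqP.
  by have := alt; move/(sortedP (true, fg1 n)).

case=> s1 [[b x] [[b' y] [s2 [Es /= /negbNE/eqP Eb]]]].
move: sN ok ps; rewrite {}Es {}Eb size_cat /= !addnS => sN.
rewrite tagged_ok_cat !tagged_ok_cons => -[ok1 [/= Hx [Hy ok2]]].
rewrite tagged_prod_cat !tagged_prod_cons /= (mulgA x) => ps.
have -> : tagged_prod (left_part (s1 ++ (b', x) :: (b', y) :: s2)) =
          tagged_prod (left_part (s1 ++ (b', x * y) :: s2)).
  rewrite /left_part !filter_cat /=; case: b' {Hx Hy} => //=.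
  by rewrite !tagged_prod_cat !tagged_prod_cons /= (mulgA x).
apply: IH; first by rewrite size_cat /= addnS.
  rewrite tagged_ok_cat tagged_ok_cons; split=> //; split=> //=.
  by case: b' Hx Hy; auto.
by rewrite tagged_prod_cat tagged_prod_cons.
Qed.

(* The graph of the retraction of the free product onto A that kills B. *)
Definition retract x a : Prop :=
  exists s, [/\ tagged_ok s, tagged_prod s = x & tagged_prod (left_part s) = a].

(** If two words represent [x], the first followed by the inverse of the second has trivial product,
    hence a trivial left part. *)
Lemma retract_fun x a b : retract x a -> retract x b -> a = b.
Proof.
case=> s [oks Es <-] [t [okt Et <-]].
have := @left_part_trivial (s ++ tagged_inv t).
rewrite tagged_ok_cat !tagged_prod_cat tagged_prod_inv Es Et mulgV.
rewrite /left_part filter_cat -/(left_part _) -/(left_part _) left_part_inv.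
rewrite tagged_prod_cat tagged_prod_inv => H.
by apply: divg1_eq; apply: H => //; split=> //; apply: tagged_ok_inv.
Qed.

Lemma retractM x y a b : retract x a -> retract y b -> retract (x * y) (a * b).
Proof.
case=> s [oks <- <-] [t [okt <- <-]]; exists (s ++ t).
by rewrite /left_part filter_cat !tagged_prod_cat; split=> //; apply/tagged_ok_cat.
Qed.

Lemma retract1 : retract 1 1.
Proof. by exists [::]; split. Qed.

Lemma retractV x a : retract x a -> retract x^-1 a^-1.
Proof.
case=> s [oks <- <-]; exists (tagged_inv s).
by rewrite left_part_inv !tagged_prod_inv; split=> //; apply: tagged_ok_inv.
Qed.

Lemma retract_id a : A a -> retract a a.
Proof.
move=> Aa; exists [:: (true, a)]; rewrite !tagged_prod_cons.
by split; rewrite ?mulg1 //; move=> p; rewrite inE => /eqP ->.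
Qed.

Lemma retract_total x : exists2 a, retract x a & A a.
Proof.
case: AB => _ _ /(_ x) gen _; move: x gen.
apply: subgen_min; first split.
- by exists 1; [exact: retract1|].
- by move=> y z [a Ra Aa] [b Rb Ab]; exists (a * b); [exact: retractM | exact: AM].
- by move=> y [a Ra Aa]; exists a^-1; [exact: retractV | exact: AV].
move=> y [Ay|By]; first by exists y => //; apply: retract_id.
exists 1 => //; exists [:: (false, y)]; rewrite tagged_prod_cons.
by split; rewrite ?mulg1 //; move=> p; rewrite inE => /eqP ->.
Qed.

(** For a subgroup [A], [lcs_in d] is the term of index d+1 of the lower central series of [A]
    itself, with the indexing of [lcs]. *)
Fixpoint lcs_in (d : nat) : FreeGroup n -> Prop :=
  if d is d'.+1 then
    subgen (fun z => exists a g, [/\ lcs_in d' a, A g & z = [~ a, g]])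
  else A.

Lemma retract_lcs d x : lcs n d x -> exists2 a, retract x a & lcs_in d a.
Proof.
elim: d x => [|d IH]; first by move=> x _; apply: retract_total.
apply: subgen_min; first split.
- by exists 1; [exact: retract1 | exact: sg1].
- by move=> y z [a Ra Aa] [b Rb Ab]; exists (a * b); [exact: retractM | exact: sgM].
- by move=> y [a Ra Aa]; exists a^-1; [exact: retractV | exact: sgV].
move=> _ [y [g [/IH [a Ra La] ->]]]; have [h Rh Ah] := retract_total g.
exists [~ a, h]; last by apply: sgS; exists a, h.
rewrite fgcommE /commg /conjg.
by apply: retractM; [exact: retractV | apply: retractM; [exact: retractV | exact: retractM]].
Qed.

(** An element of [A] is its own retraction, and the retraction carries the lower central series of
    the whole group into that of [A]. *)
Lemma lcs_factor d x : lcs n d x -> A x -> lcs_in d x.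
Proof.
by move=> /retract_lcs [a Ra La] /retract_id Rx; rewrite (retract_fun Rx Ra).
Qed.

Lemma lcs_in_lcs d x : lcs_in d x -> lcs n d x.
Proof.
elim: d x => [|d IH] //=; apply: subgen_min; first exact: subgen_is_subgroup.
by move=> _ [a [g [/IH La _ ->]]]; apply: sgS; exists a, g; rewrite fgcommE.
Qed.

End Retraction.

(** * Leading terms of the Magnus expansion *)

Section Leading.
Local Open Scope ring_scope.
Variables n m : nat.
Implicit Types (l : nat -> 'I_n -> int) (x y g : FreeGroup n).

(** Each bracketing raises the lowest degree by one; this is the easy inclusion between the lower
    central series and the Magnus filtration. *)
Lemma magnus_pos_lcs l d x :
  lcs n d x -> upper_from d.+1 (magnus_pos m l x).
Proof.
elim: d x => [|d IH]; first by move=> x _; apply: magnus_pos_upper.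
apply: subgen_min; first split.
- by rewrite -[fg1 n]/(1%g : FreeGroup n) magnus_pos1 => i j _; rewrite mxE.
- by move=> y z; apply: magnus_posM_upper.
- by move=> y; apply: magnus_posV_upper.
by move=> _ [a [g [/IH Ha ->]]]; rewrite fgcommE; apply: magnus_pos_comm_upper.
Qed.

Variables (r : nat) (s : 'I_r -> FreeGroup n).

(** The word [w] stands for a pure tensor in the classes of the elements [s j], paired with the
    forms [l a], [l a.+1], and so on. *)
Fixpoint monom l (a : nat) (w : seq 'I_r) : int :=
  if w is j :: w' then expsum l a (s j) * monom l a.+1 w' else 1.

Definition lincomb l a (L : seq (int * seq 'I_r)) : int :=
  \sum_(p <- L) p.1 * monom l a p.2.

Lemma monom_cat l a v w : monom l a (v ++ w) = monom l a v * monom l (a + size v)%N w.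
Proof.
elim: v a => [|j v IH] a /=; first by rewrite mul1r addn0.
by rewrite IH mulrA addnS addSn.
Qed.

Lemma monomE l a w j0 :
  monom l a w = \prod_(t < size w) expsum l (a + t)%N (s (nth j0 w t)).
Proof.
elim: w a => [|j w IH] a /=; first by rewrite big_ord0.
rewrite big_ord_recl addn0 IH; congr (_ * _).
by apply: eq_bigr => t _; rewrite /= /bump /= add1n addnS.
Qed.

Definition lin_opp (L : seq (int * seq 'I_r)) := [seq (- p.1, p.2) | p <- L].
Definition lin_mul (L K : seq (int * seq 'I_r)) :=
  [seq (p.1 * q.1, p.2 ++ q.2) | p <- L, q <- K].
Definition homog d (L : seq (int * seq 'I_r)) := all (fun p => size p.2 == d) L.

Lemma lincomb_cat l a L K : lincomb l a (L ++ K) = lincomb l a L + lincomb l a K.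
Proof. exact: big_cat. Qed.

Lemma lincomb_opp l a L : lincomb l a (lin_opp L) = - lincomb l a L.
Proof.
by rewrite /lincomb big_map -sumrN; apply: eq_bigr => p _; rewrite mulNr.
Qed.

(** Homogeneity of [L] fixes the position a+d at which every word of [K] starts. *)
Lemma lincomb_mul l a d L K :
  homog d L -> lincomb l a (lin_mul L K) = lincomb l a L * lincomb l (a + d)%N K.
Proof.
move=> /allP HL; rewrite /lincomb big_allpairs_dep /= mulr_suml big_seq [RHS]big_seq.
apply: eq_bigr => p /HL /eqP sp; rewrite mulr_sumr; apply: eq_bigr => q _.
by rewrite monom_cat sp mulrACA.
Qed.

Lemma homog_cat d L K : homog d L -> homog d K -> homog d (L ++ K).
Proof. by rewrite /homog all_cat => -> ->. Qed.

Lemma homog_opp d L : homog d L -> homog d (lin_opp L).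
Proof. by rewrite /homog all_map. Qed.

Lemma homog_mul d e L K : homog d L -> homog e K -> homog (d + e)%N (lin_mul L K).
Proof.
move=> /allP HL /allP HK; apply/allP => _ /allpairsP [[p q] /= [/HL sp /HK sq ->]].
by rewrite size_cat (eqP sp) (eqP sq).
Qed.

Variable A : FreeGroup n -> Prop.
Hypothesis genA : forall x, A x -> subgen (fun y => exists j, y = s j) x.

Lemma expsum_lin x :
  A x -> exists2 L, homog 1%N L & forall l a, expsum l a x = lincomb l a L.
Proof.
move/genA; move: x; apply: subgen_min; first split.
- by exists [::] => // l a; rewrite -[fg1 n]/(1%g : FreeGroup n) expsum1 /lincomb big_nil.
- move=> y z [L HL EL] [K HK EK]; exists (L ++ K) => [|l a]; first exact: homog_cat.
  by rewrite -[fgmul y z]/(y * z)%g expsumM EL EK lincomb_cat.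
- move=> y [L HL EL]; exists (lin_opp L) => [|l a]; first exact: homog_opp.
  by rewrite -[fginv y]/(y^-1)%g expsumV EL lincomb_opp.
move=> _ [j ->]; exists [:: (1, [:: j])] => // l a.
by rewrite /lincomb big_seq1 /= mulr1 mul1r.
Qed.

(** The leading term is a tensor in the generators of [A]. One [L] serves all weights, so weights
    can later be summed over with [L] fixed. *)
Lemma magnus_pos_lin d x :
  lcs_in A d x -> exists2 L, homog d.+1 L &
    forall l (a b : 'I_m.+1), b = (a + d.+1)%N :> nat ->
      magnus_pos m l x a b = lincomb l a L.
Proof.
elim: d x => [|d IH] x.
  case/expsum_lin=> L HL EL; exists L => // l a b Eb.
  by rewrite magnus_pos_expsum ?EL // Eb addn1.
(* Membership in [lcs] is carried through the induction, because leading entries are additive only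
   for elements of that depth. *)
move=> Lx; suff [] : lcs n d.+1 x /\ exists2 L, homog d.+2 L &
    forall l (a b : 'I_m.+1), b = (a + d.+2)%N :> nat ->
      magnus_pos m l x a b = lincomb l a L by [].
move: x Lx; apply: subgen_min; first split.
- split; first exact: sg1.
  exists [::] => // l a b _; rewrite -[fg1 n]/(1%g : FreeGroup n) magnus_pos1 mxE.
  by rewrite /lincomb big_nil.
- move=> y z [Ly [L HL EL]] [Lz [K HK EK]]; split; first exact: sgM.
  exists (L ++ K) => [|l a b Eb]; first exact: homog_cat.
  rewrite -[fgmul y z]/(y * z)%g lincomb_cat -(EL _ _ b) // -(EK _ _ b) //.
  by apply: (magnus_pos_mul_lead _ _ Eb); apply: magnus_pos_lcs.
- move=> y [Ly [L HL EL]]; split; first exact: sgV.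
  exists (lin_opp L) => [|l a b Eb]; first exact: homog_opp.
  rewrite -[fginv y]/(y^-1)%g lincomb_opp -(EL _ _ b) //.
  by apply: (magnus_posV_lead _ Eb); apply: magnus_pos_lcs.
move=> _ [g [h [Lg Ah ->]]]; have lg := lcs_in_lcs Lg.
split; first by apply: sgS; exists g, h; rewrite fgcommE.
have [L HL EL] := IH _ Lg; have [K HK EK] := expsum_lin Ah.
exists (lin_mul L K ++ lin_opp (lin_mul K L)) => [|l a b Eb].
  apply: homog_cat; last apply: homog_opp.
    by rewrite -[d.+2]addn1; apply: homog_mul.
  by rewrite -[d.+2]add1n; apply: homog_mul.
have c_lt : (a + d.+1 < m.+1)%N.
  by apply: leq_ltn_trans (ltn_ord b); rewrite Eb leq_add2l.
have c'_lt : (a.+1 < m.+1)%N.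
  by apply: leq_ltn_trans (ltn_ord b); rewrite Eb -addn1 leq_add2l.
rewrite (@magnus_pos_comm_lead _ _ l g h d a b (Ordinal c_lt) (Ordinal c'_lt)) //.
  rewrite lincomb_cat lincomb_opp (lincomb_mul _ _ _ HL) (lincomb_mul _ _ _ HK).
  rewrite (EL l a) // !EK (EL l (Ordinal c'_lt) b) ?addn1 //=.
  by rewrite Eb addSn addnS.
exact: magnus_pos_lcs.
Qed.

End Leading.

(** * The alternating coefficient *)

Section AlternatingTrace.
Local Open Scope ring_scope.
Variables n k : nat.
Implicit Types (x y g : FreeGroup n) (sg : 'S_k).

Definition coord (c : nat) (i : 'I_n) : int := (i == c :> nat)%:R.

(** Position 0 reads x_0 and position t+1 reads x_(sg t + 1). Weights are indexed by all naturals,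
    so positions beyond [k] get the zero form. *)
Definition alt_weight sg (a : nat) : 'I_n -> int :=
  if a is t.+1 then
    if insub t is Some t' then coord (sg t').+1 else fun=> 0
  else coord 0.

(* sum over sg of sgn(sg) times the Magnus coefficient of the word
   x_0 x_(sg 1) .. x_(sg k). *)
Definition alt_coef x : int :=
  \sum_(sg : 'S_k) (-1) ^+ sg * magnus k.+1 (alt_weight sg) x ord0 ord_max.

Lemma alt_weightS sg (t : 'I_k) : alt_weight sg t.+1 = coord (sg t).+1.
Proof. by rewrite /= insubT // => tk; congr (coord (sg _).+1); apply: val_inj. Qed.

(** The corner is the last superdiagonal, and [M - 1] pushes [X] past it. *)
Lemma corner_mulr (M X : 'M[int]_k.+2) :
  upper_from k.+1 X -> upper_from 1 (M - 1) ->
  (M * X) ord0 ord_max = X ord0 ord_max.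
Proof.
by move=> HX HM; rewrite -[M](subrK 1) mulrDl mul1r mxE (upper_fromM HM HX) ?add0r.
Qed.

Lemma corner_mull (M X : 'M[int]_k.+2) :
  upper_from k.+1 X -> upper_from 1 (M - 1) ->
  (X * M) ord0 ord_max = X ord0 ord_max.
Proof.
move=> HX HM; rewrite -[M](subrK 1) mulrDr mulr1 mxE (upper_fromM HX HM) ?add0r //.
by rewrite add0n addn1.
Qed.

Variables (f : FreeGroup n -> FreeGroup n) (fIA : IA n k f).

(** Its corner entry is the Johnson homomorphism of [f] at [x], paired with the weights [l]. *)
Definition shift l x : 'M[int]_k.+2 := magnus k.+1 l (f x) - magnus k.+1 l x.

Lemma shiftE l x :
  shift l x = magnus k.+1 l x * magnus_pos k.+1 l (x^-1 * f x)%g.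
Proof. by rewrite /shift /magnus_pos mulrBr mulr1 -magnusM mulVKg. Qed.

Lemma shift_upper l x : upper_from k.+1 (shift l x).
Proof.
have H : upper_from k.+1 (magnus_pos k.+1 l (x^-1 * f x)%g).
  by apply: magnus_pos_lcs; case: fIA => _; apply.
rewrite shiftE -[magnus _ _ x](subrK 1) mulrDl mul1r; apply: upper_fromD => //.
by apply: upper_fromW (upper_fromM (magnus_pos_upper l x) H); rewrite add1n.
Qed.

Lemma shift_corner l x :
  shift l x ord0 ord_max = magnus_pos k.+1 l (x^-1 * f x)%g ord0 ord_max.
Proof.
rewrite shiftE corner_mulr //; last exact: magnus_pos_upper.
by apply: magnus_pos_lcs; case: fIA => _; apply.
Qed.

(** The difference splits as shift(x) M(f y) + M(x) shift(y), and the unipotent factors leave the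
    corner unchanged. *)
Lemma shiftM l x y :
  shift l (x * y)%g ord0 ord_max = shift l x ord0 ord_max + shift l y ord0 ord_max.
Proof.
have fM : is_hom f by case: fIA => -[].
have -> : shift l (x * y)%g = shift l x * magnus k.+1 l (f y) + magnus k.+1 l x * shift l y.
  by rewrite /shift (homM fM) !magnusM mulrBl mulrBr addrA subrK.
rewrite mxE corner_mull ?corner_mulr //; try exact: shift_upper; exact: magnus_pos_upper.
Qed.

Lemma shift1 l : shift l 1%g = 0.
Proof. by have fM : is_hom f; [case: fIA => -[] | rewrite /shift (hom1 fM) subrr]. Qed.

Lemma shiftV l x : shift l x^-1%g ord0 ord_max = - shift l x ord0 ord_max.
Proof. by apply/eqP; rewrite -addr_eq0 -shiftM mulVg shift1 mxE. Qed.

Definition alt_shift x : int :=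
  \sum_(sg : 'S_k) (-1) ^+ sg * shift (alt_weight sg) x ord0 ord_max.

Lemma alt_shiftE x : alt_shift x = alt_coef (f x) - alt_coef x.
Proof.
rewrite /alt_shift /alt_coef -sumrB; apply: eq_bigr => sg _.
by rewrite /shift 2!mxE mulrBr.
Qed.

(** This reduces invariance of [alt_coef] to a check on the two factors of a splitting. *)
Lemma alt_shift_subgroup : is_subgroup (fun x => alt_shift x = 0).
Proof.
split.
- rewrite /alt_shift big1 // => sg _.
  by rewrite -[fg1 n]/(1%g : FreeGroup n) shift1 mxE mulr0.
- move=> x y Hx Hy; rewrite -[RHS](addr0 0) -{1}Hx -Hy /alt_shift -big_split /=.
  by apply: eq_bigr => sg _; rewrite -mulrDr -shiftM.
- move=> x Hx; rewrite -[RHS]oppr0 -Hx /alt_shift -sumrN.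
  by apply: eq_bigr => sg _; rewrite -mulrN -shiftV.
Qed.

End AlternatingTrace.

(** * Invariance under automorphisms supported on splittings of small rank *)

Section Supported.
Local Open Scope ring_scope.
Variables n k r : nat.
Variable s : 'I_r -> FreeGroup n.
Hypothesis rk : (r < k)%N.

(* The signed sum is a k x k determinant whose rows are indexed by at most r < k
   vectors, so two rows coincide. *)
Lemma alt_monom0 (w : seq 'I_r) :
  size w = k.+1 ->
  \sum_(sg : 'S_k) (-1) ^+ sg * monom s (@alt_weight n k sg) 0 w = 0.
Proof.
case: w => // j0 w [sw].
pose X : 'M[int]_k :=
  \matrix_(t < k, i < k) expsum (fun=> @coord n i.+1) 0 (s (nth j0 w t)).
have EX (sg : 'S_k) : monom s (@alt_weight n k sg) 0 (j0 :: w) =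
    expsum (fun=> @coord n 0) 0 (s j0) * \prod_(t < k) X t (sg t).
  rewrite /= (monomE _ _ _ _ j0) sw; congr (_ * _).
  apply: eq_bigr => t _; rewrite mxE /expsum add1n; apply: eq_bigr => c _.
  by rewrite alt_weightS.
under eq_bigr do rewrite EX mulrCA.
rewrite -mulr_sumr -/(determinant X).
suff -> : \det X = 0 by rewrite mulr0.
have /injectivePn [t1 [t2 ne E]] : ~~ injectiveb (fun t : 'I_k => nth j0 w t).
  apply/negP => /injectiveP inj; have := leq_card _ inj.
  by rewrite !card_ord leqNgt rk.
by apply: (determinant_alternate ne) => i; rewrite !mxE E.
Qed.

Variables A B : FreeGroup n -> Prop.
Hypothesis AB : splitting A B.
Hypothesis genA : forall x, A x -> subgen (fun y => exists j, y = s j) x.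

Lemma alt_coef_supported f :
  IA n k f -> supported f A B -> forall x, alt_coef k (f x) = alt_coef k x.
Proof.
move=> fIA [fA _ fB] x; apply/eqP; rewrite -subr_eq0 -(alt_shiftE k f); apply/eqP.
case: (AB) => -[_ AM AV] _ /(_ x) gen _; move: x gen.
apply: subgen_min; first exact: alt_shift_subgroup.
move=> x [Ax|Bx]; last first.
  by rewrite alt_shiftE fB // subrr.
have Lx : lcs_in A k (x^-1 * f x)%g.
  apply: (lcs_factor AB); first by case: fIA => _; apply.
  by apply: AM; [apply: AV | apply: fA].
have [L /allP HL EL] := magnus_pos_lin k.+1 genA Lx.
rewrite /alt_shift.
under eq_bigr => sg _ do rewrite shift_corner // (EL _ ord0 ord_max) //= mulr_sumr.
(* Since [L] is the same for every permutation, the signed sum can be taken word by word. *)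
rewrite exchange_big /= big_seq big1 // => p /HL /eqP sp.
under eq_bigr do rewrite mulrCA.
by rewrite -mulr_sumr alt_monom0 // mulr0.
Qed.

End Supported.

Lemma In_nth (T : Type) (x0 y : T) (s : seq T) :
  List.In y s -> exists2 j, j < size s & y = nth x0 s j.
Proof.
elim: s => //= z s IH [->|/IH [j js Ej]]; first by exists 0.
by exists j.+1.
Qed.

(** Invariance, stated as an equation for all [x], passes directly to composites and inverses. *)
Lemma alt_coef_autgen n k f :
  autgen (fun psi => IA n k psi /\
            exists A B : FreeGroup n -> Prop,
              [/\ splitting A B, rank_lt A k & supported psi A B]) f ->
  forall x, alt_coef k (f x) = alt_coef k x.
Proof.
elim=> {f} [|f [fIA [A [B [AB [s [sk genA]] fAB]]]]|f g _ IHf _ IHg|f g _ IH fK gK] x //.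
(* The list generating [A] becomes a family indexed by the ordinals below its length. *)
- apply: (@alt_coef_supported n k _ (fun j => nth (fg1 n) s (nat_of_ord j)) sk A B) => //.
  move=> y /genA; move: y; apply: subgen_min; first exact: subgen_is_subgroup.
  by move=> y /(In_nth (fg1 n)) [j js ->]; apply: sgS; exists (Ordinal js).
- by rewrite /= IHf IHg.
- by rewrite -{2}(gK x) IH.
Qed.

(** * An automorphism in IA_n(k) that changes the alternating coefficient *)

Section Witness.
Local Open Scope group_scope.
Variables n' k : nat.
Local Notation n := n'.+1.

Definition gen_x (i : nat) : FreeGroup n := fgen (inord i).

Fixpoint iter_comm (d : nat) : FreeGroup n :=
  if d is d'.+1 then [~ iter_comm d', gen_x d] else gen_x 0.

Lemma lcs_iter_comm d : lcs n d (iter_comm d).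
Proof.
elim: d => //= d IH; apply: sgS; exists (iter_comm d), (gen_x d.+1).
by rewrite fgcommE.
Qed.

Definition conj_letter (j : 'I_n) (u : FreeGroup n) (c : letter n) : FreeGroup n :=
  let x := if c.1 == j then fgen j ^ u else fgen c.1 in if c.2 then x^-1 else x.

Definition conj_aut j u : FreeGroup n -> FreeGroup n :=
  fg_ev *%g (conj_letter j u).

Lemma conj_aut_hom j u : is_hom (conj_aut j u).
Proof.
by apply: fg_evM => -[i []] /=; rewrite /conj_letter /= ?mulVg ?mulgV.
Qed.

Lemma conj_aut_fgen j u i :
  conj_aut j u (fgen i) = if i == j then fgen j ^ u else fgen i.
Proof. by rewrite /conj_aut /fg_ev big_seq1. Qed.

Lemma fix_subgroup f : is_hom f -> is_subgroup (fun x : FreeGroup n => f x = x).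
Proof.
move=> fM; split; first exact: hom1.
  by move=> x y fx fy; rewrite fM fx fy.
by move=> x fx; rewrite -[fginv x]/(x^-1) homV // fx.
Qed.

(** The hypothesis expresses that [u] does not involve x_j; then conjugating x_j by [u^-1] undoes
    conjugating it by [u]. *)
Lemma conj_autK j u : (forall v, conj_aut j v u = u) ->
  cancel (conj_aut j u) (conj_aut j u^-1).
Proof.
move=> fu x; apply: (fg_ind (P := fun x => conj_aut j u^-1 (conj_aut j u x) = x)).
  apply: (@fix_subgroup (conj_aut j u^-1 \o conj_aut j u)) => y z /=.
  by rewrite !conj_aut_hom.
move=> i; rewrite conj_aut_fgen; case: eqP => [->|/eqP ne].
  by rewrite (homJ (conj_aut_hom _ _)) fu conj_aut_fgen eqxx -conjgM mulVg conjg1.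
by rewrite conj_aut_fgen (negbTE ne).
Qed.

Lemma conj_aut_bij j u :
  (forall v, conj_aut j v u = u) -> bijective (conj_aut j u).
Proof.
move=> fu; exists (conj_aut j u^-1); first exact: conj_autK.
rewrite -{2}(invgK u); apply: conj_autK => v.
by rewrite (homV (conj_aut_hom j v)) fu.
Qed.

Hypothesis k_gt0 : 0 < k.
Hypothesis kn : k < n.

(** The conjugator involves only x_0, .., x_(k-1), which makes the map bijective, and lies in the
    k-th term of the lower central series, so it moves x_k by an element of the next term. *)
Definition witness := conj_aut (inord k) (iter_comm k.-1).

Lemma conj_aut_iter_comm v d :
  d < k -> conj_aut (inord k) v (iter_comm d) = iter_comm d.
Proof.
have fM := conj_aut_hom (inord k) v.
have fx i : i < k -> conj_aut (inord k) v (gen_x i) = gen_x i.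
  move=> ik; rewrite conj_aut_fgen -val_eqE /= !inordK ?(ltn_trans ik) //.
  by rewrite ltn_eqF.
elim: d => [|d IH] dk; first exact: fx.
have fR := fix_subgroup fM; case: fR => _ RM RV.
have Id := IH (ltnW dk); have Ix := fx _ dk.
rewrite /= -fgcommE; apply: (RM _ _ (RM _ _ (RV _ _) (RV _ _)) (RM _ _ _ _)) => //.
Qed.

Lemma witness_gen : (gen_x k)^-1 * witness (gen_x k) = (iter_comm k)^-1.
Proof.
rewrite /witness conj_aut_fgen eqxx -/(gen_x k) -[in RHS](prednK k_gt0) /=.
by rewrite prednK // invgR.
Qed.

Lemma witness_IA : IA n k witness.
Proof.
have fM := conj_aut_hom (inord k) (iter_comm k.-1).
split.
  by split=> //; apply: conj_aut_bij => v; rewrite conj_aut_iter_comm ?prednK.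
move=> x; apply: (IA_of_gens fM) => i.
have [->|ne] := eqVneq i (inord k).
  rewrite -/witness -/(gen_x k) witness_gen.
  by case: (lcs_is_subgroup n k) => _ _; apply; apply: lcs_iter_comm.
rewrite conj_aut_fgen (negbTE ne) mulVg.
by case: (lcs_is_subgroup n k).
Qed.

Local Open Scope ring_scope.

(* Only the term in which every bracket is expanded with the new generator on
   the right survives, since l 0 kills x_1, .., x_k. *)
Lemma magnus_iter_comm m (l : nat -> 'I_n -> int) d (b : 'I_m.+1) :
  (forall i, (0 < i <= d)%N -> l 0%N (inord i) = 0) -> b = d.+1 :> nat ->
  magnus_pos m l (iter_comm d) ord0 b = \prod_(t < d.+1) l t (inord t).
Proof.
elim: d b => [|d IH] b l0 Eb.
  by rewrite magnus_pos_expsum // expsum_fgen big_ord1.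
have c_lt : (d.+1 < m.+1)%N by rewrite -Eb ltnW.
have c'_lt : (1 < m.+1)%N by apply: leq_ltn_trans c_lt.
rewrite (@magnus_pos_comm_lead _ _ l _ _ d ord0 b (Ordinal c_lt) (Ordinal c'_lt)) //.
  rewrite !expsum_fgen /= l0 ?ltn0Sn ?leqnn // mul0r subr0 add0n IH //.
    by rewrite [RHS]big_ord_recr.
  by move=> i /andP [i0 id]; rewrite l0 // i0 ltnW.
by apply: magnus_pos_lcs; apply: lcs_iter_comm.
Qed.

Lemma alt_coef_witness :
  alt_coef k (witness (gen_x k)) - alt_coef k (gen_x k) = -1.
Proof.
rewrite -(alt_shiftE k witness) /alt_shift.
have E (sg : 'S_k) : shift k witness (alt_weight sg) (gen_x k) ord0 ord_max =
    - (sg == 1%g)%:R.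
  rewrite (shift_corner witness_IA) witness_gen.
  rewrite (@magnus_posV_lead _ _ _ _ k) //; last by apply: magnus_pos_lcs; apply: lcs_iter_comm.
  (* The side condition holds because position 0 carries [coord 0], which vanishes on x_1, ..,
     x_k. *)
  rewrite magnus_iter_comm //; last first.
    move=> i /andP [i0 ik]; rewrite /= /coord inordK; last exact: leq_ltn_trans ik kn.
    by rewrite eqn0Ngt i0.
  congr (- _); rewrite big_ord_recl [X in X * _](_ : _ = 1); last first.
    by rewrite /= /coord inordK // eqxx.
  rewrite mul1r.
  case: eqP => [->|ne].
    rewrite big1 // => t _; rewrite lift0 alt_weightS perm1 /coord inordK ?eqxx //.
    exact: leq_ltn_trans (ltn_ord t) kn.
  apply/eqP; apply/prodf_eq0.
  (* A permutation other than the identity moves some [t], and the factor at position t+1 is then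
     0. *)
  have [t nt] : exists t, sg t != t.
    apply/existsP; apply: contra_notT ne => /existsPn fx.
    by apply/permP => t; rewrite perm1; apply/eqP/negbNE/fx.
  exists t => //; rewrite lift0 alt_weightS /coord inordK.
    by rewrite eqSS val_eqE (eq_sym t) (negbTE nt).
  exact: leq_ltn_trans (ltn_ord t) kn.
rewrite (bigD1 (1%g : 'S_k)) //= big1 => [|sg /negbTE ne]; last by rewrite E ne oppr0 mulr0.
by rewrite E eqxx odd_perm1 expr0 mul1r addr0.
Qed.

End Witness.

Theorem theoremD (k n : nat) :
  1 <= k -> k < n ->
  ~ (forall phi : FreeGroup n -> FreeGroup n,
       IA n k phi ->
       autgen (fun psi => IA n k psi /\
                 exists A B : FreeGroup n -> Prop,
                   [/\ splitting A B, rank_lt A k & supported psi A B]) phi).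
Proof.
(* The rank is exposed as a successor because [inord], used to name the generators, needs a nonempty
   index type. *)
case: n => [|n'] // k_gt0 kn /(_ _ (witness_IA k_gt0 kn)) gen.
have := alt_coef_witness k_gt0 kn.
by rewrite (alt_coef_autgen gen) GRing.subrr.
Qed.
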